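(* Regard the groups $\mathcal S(\mathbb N)$ and $\mathcal S(\mathbb N)^{\times 3}$ as one-object categories, so that the group homomorphisms $(\_\star\_\star\_)$, $((\_\star\_)\star\_)$ and $(\_\star(\_\star\_))$ from $\mathcal S(\mathbb N)^{\times 3}$ to $\mathcal S(\mathbb N)$ are functors. There exist natural isomorphisms 1. $(\_\star\_\star\_)\Rightarrow((\_\star\_)\star\_)$, 2. $(\_\star\_\star\_)\Rightarrow(\_\star(\_\star\_))$, whose unique components are, respectively, 1. the reduced Collatz bijection $\lambda\in\mathcal S(\mathbb N)$, 2. the original Collatz bijection $\rho\in\mathcal S(\mathbb N)$. Explicitly, for all $f,g,h\in\mathcal S(\mathbb N)$, $\lambda\,(f\star g\star h)=((f\star g)\star h)\,\lambda$ and $\rho\,(f\star g\star h)=(f\star(g\star h))\,\rho$.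
   Context: $\mathbb N=\{0,1,2,\dots\}$, and $\mathcal S(\mathbb N)$ is the group of all bijections $\mathbb N\to\mathbb N$ under composition of functions. The original Collatz bijection $\rho\in\mathcal S(\mathbb N)$ is given by $\rho(n)=\frac{2n}{3}$ if $n\equiv 0 \pmod 3$, $\rho(n)=\frac{4n-1}{3}$ if $n\equiv 1\pmod 3$, $\rho(n)=\frac{4n+1}{3}$ if $n\equiv 2\pmod 3$. The reduced Collatz bijection $\lambda\in\mathcal S(\mathbb N)$ is $\lambda(n)=\rho(n+1)-1$; explicitly $\lambda(n)=\frac{4n}{3}$ if $n\equiv 0\pmod 3$, $\frac{4n+2}{3}$ if $n\equiv 1\pmod 3$, $\frac{2n-1}{3}$ if $n\equiv 2\pmod 3$. Girard's conjunction is the injective group homomorphism $\_\star\_:\mathcal S(\mathbb N)\times\mathcal S(\mathbb N)\to\mathcal S(\mathbb N)$ given by $(a\star b)(n)=2a\left(\frac n2\right)$ for $n$ even and $(a\star b)(n)=2b\left(\frac{n-1}{2}\right)+1$ for $n$ odd. The homomorphism $(\_\star\_\star\_):\mathcal S(\mathbb N)^{\times 3}\to\mathcal S(\mathbb N)$ (a single ternary operation) is given by $(f\star g\star h)(n)=3f\left(\frac n3\right)$ if $n\equiv 0\pmod 3$, $3g\left(\frac{n-1}{3}\right)+1$ if $n\equiv 1\pmod 3$, $3h\left(\frac{n-2}{3}\right)+2$ if $n\equiv 2\pmod 3$. A natural isomorphism between functors $F,G$ of one-object categories $M\to N$ (with $M,N$ groups) has a single component $t\in N$, satisfying $t\,F(m)=G(m)\,t$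 for all $m\in M$. *)

(* Defs.v *)
From HB Require Import structures.
From mathcomp Require Import all_boot.
From mathcomp Require Import boolp.
From mathcomp Require Import zify.

Set Implicit Arguments.
Unset Strict Implicit.
Unset Printing Implicit Defensive.

Record category := Category {
  obj :> Type;
  hom : obj -> obj -> Type;
  idm : forall x, hom x x;
  comp : forall x y z, hom y z -> hom x y -> hom x z;
  comp1m : forall x y (f : hom x y), comp (idm y) f = f;
  compm1 : forall x y (f : hom x y), comp f (idm x) = f;
  compA : forall x y z t (f : hom z t) (g : hom y z) (h : hom x y),
    comp f (comp g h) = comp (comp f g) h
}.

Definition is_iso (C : category) (x y : C) (f : hom x y) : Prop :=
  exists g : hom y x, comp g f = idm x /\ comp f g = idm y.

Record functor (C D : category) := Functor {
  fobj :> C -> D;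
  fmap : forall x y, hom x y -> hom (fobj x) (fobj y);
  fmap1 : forall x, fmap (idm x) = idm (fobj x);
  fmapM : forall x y z (f : hom y z) (g : hom x y),
    fmap (comp f g) = comp (fmap f) (fmap g)
}.

Record nat_trans (C D : category) (F G : functor C D) := NatTrans {
  component :> forall x : C, hom (F x) (G x);
  naturality : forall (x y : C) (f : hom x y),
    comp (component y) (fmap F f) = comp (fmap G f) (component x)
}.

Definition is_nat_iso (C D : category) (F G : functor C D)
    (eta : nat_trans F G) : Prop :=
  forall x : C, is_iso (eta x).

Definition one_object (M : groupType) : category :=
  @Category unit (fun _ _ => M) (fun _ => 1%g) (fun _ _ _ f g => (f * g)%g)
    (fun _ _ => @mul1g M) (fun _ _ => @mulg1 M)
    (fun _ _ _ _ => @mulgA M).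

Definition hom_functor (M N : groupType) (F : UMagmaMorphism.type M N) :
    functor (one_object M) (one_object N) :=
  @Functor (one_object M) (one_object N) id (fun _ _ m => F m)
    (fun _ => @gmulf1 _ _ F) (fun _ _ _ => @gmulfM _ _ F).

(* The group of bijections of nat; the product a * b is a \o b. *)
Record SN := MkSN { SN_fun :> nat -> nat; SN_bij : bijective SN_fun }.

Lemma SN_eqP (a b : SN) : a =1 b -> a = b.
Proof.
case: a b => [f bf] [g bg] /= /funext fg; subst g.
by rewrite (Prop_irrelevance bf bg).
Qed.

Lemma SN_surj (a : SN) (n : nat) : exists m, a m == n.
Proof. by case: (SN_bij a) => b _ bK; exists (b n); rewrite bK. Qed.

Definition SN_inv_fun (a : SN) (n : nat) : nat := xchoose (SN_surj a n).

Lemma SN_invK (a : SN) : cancel (SN_inv_fun a) a.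
Proof. by move=> n; apply/eqP; exact: (xchooseP (SN_surj a n)). Qed.

Lemma SN_funK (a : SN) : cancel a (SN_inv_fun a).
Proof. by move=> n; apply: (bij_inj (SN_bij a)); rewrite SN_invK. Qed.

Definition SN_id : SN :=
  MkSN (Bijective (fun=> erefl) (fun=> erefl) : bijective id).
Definition SN_comp (a b : SN) : SN := MkSN (bij_comp (SN_bij a) (SN_bij b)).
Definition SN_inv (a : SN) : SN :=
  MkSN (Bijective (@SN_invK a) (@SN_funK a)).

HB.instance Definition _ := gen_eqMixin SN.
HB.instance Definition _ := gen_choiceMixin SN.

Fact SN_mulA : associative SN_comp.
Proof. by move=> a b c; apply: SN_eqP. Qed.
Fact SN_1mul : left_id SN_id SN_comp.
Proof. by move=> a; apply: SN_eqP. Qed.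
Fact SN_mul1 : right_id SN_id SN_comp.
Proof. by move=> a; apply: SN_eqP. Qed.
Fact SN_Vmul : left_inverse SN_id SN_inv SN_comp.
Proof. by move=> a; apply: SN_eqP => n /=; rewrite SN_funK. Qed.
Fact SN_mulV : right_inverse SN_id SN_inv SN_comp.
Proof. by move=> a; apply: SN_eqP => n /=; rewrite SN_invK. Qed.

HB.instance Definition _ :=
  isGroup.Build SN SN_mulA SN_1mul SN_mul1 SN_Vmul SN_mulV.

(* In all the functions on nat below, every division is exact and no
   subtraction is truncated. *)

Definition rho_fun (n : nat) : nat :=
  if n %% 3 == 0 then (2 * n) %/ 3
  else if n %% 3 == 1 then (4 * n - 1) %/ 3
  else (4 * n + 1) %/ 3.

Definition rho_inv_fun (m : nat) : nat :=
  if m %% 2 == 0 then (3 * m) %/ 2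
  else if m %% 4 == 1 then (3 * m + 1) %/ 4
  else (3 * m - 1) %/ 4.

Lemma rho_funK : cancel rho_fun rho_inv_fun.
Proof.
move=> n; rewrite /rho_fun; do ?case: ifP => ?; rewrite /rho_inv_fun;
by do ?case: ifP => ?; lia.
Qed.

Lemma rho_inv_funK : cancel rho_inv_fun rho_fun.
Proof.
move=> n; rewrite /rho_inv_fun; do ?case: ifP => ?; rewrite /rho_fun;
by do ?case: ifP => ?; lia.
Qed.

Definition rho : SN := MkSN (Bijective rho_funK rho_inv_funK).

Definition lambda_fun (n : nat) : nat := rho (n + 1) - 1.
Definition lambda_inv_fun (m : nat) : nat := rho_inv_fun (m + 1) - 1.

Lemma lambda_funK : cancel lambda_fun lambda_inv_fun.
Proof.
move=> n; rewrite /lambda_inv_fun /lambda_fun /= subnK ?rho_funK ?addnK //.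
by rewrite /rho_fun; do ?case: ifP => ?; lia.
Qed.

Lemma lambda_inv_funK : cancel lambda_inv_fun lambda_fun.
Proof.
move=> n; rewrite /lambda_inv_fun /lambda_fun /= subnK ?rho_inv_funK ?addnK //.
by rewrite /rho_inv_fun; do ?case: ifP => ?; lia.
Qed.

Definition lambda : SN := MkSN (Bijective lambda_funK lambda_inv_funK).

Lemma lambdaE (n : nat) :
  lambda n = if n %% 3 == 0 then (4 * n) %/ 3
             else if n %% 3 == 1 then (4 * n + 2) %/ 3
             else (2 * n - 1) %/ 3.
Proof. by rewrite /= /lambda_fun /= /rho_fun; do ?case: ifP => ?; lia. Qed.

Definition star_fun (a b : nat -> nat) (n : nat) : nat :=
  if n %% 2 == 0 then 2 * a (n %/ 2) else 2 * b ((n - 1) %/ 2) + 1.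

Lemma star_fun_comp (a b c d : nat -> nat) :
  star_fun a b \o star_fun c d =1 star_fun (a \o c) (b \o d).
Proof.
move=> n; rewrite /star_fun /=; case: (n %% 2 == 0).
  by rewrite modnMr /= mulKn.
by rewrite mulnC modnMDl /= addnK mulnK.
Qed.

Lemma star_fun_id (a b : nat -> nat) :
  a =1 id -> b =1 id -> star_fun a b =1 id.
Proof. by move=> ea eb n; rewrite /star_fun ea eb; do ?case: ifP => ?; lia. Qed.

Lemma star_fun_bij (a b : SN) : bijective (star_fun a b).
Proof.
exists (star_fun (SN_inv_fun a) (SN_inv_fun b)) => n.
  rewrite -[LHS]/((_ \o _) n) star_fun_comp.
  by apply: star_fun_id => m /=; rewrite SN_funK.
rewrite -[LHS]/((_ \o _) n) star_fun_comp.
by apply: star_fun_id => m /=; rewrite SN_invK.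
Qed.

Definition star (a b : SN) : SN := MkSN (star_fun_bij a b).

Definition star3_fun (f g h : nat -> nat) (n : nat) : nat :=
  if n %% 3 == 0 then 3 * f (n %/ 3)
  else if n %% 3 == 1 then 3 * g ((n - 1) %/ 3) + 1
  else 3 * h ((n - 2) %/ 3) + 2.

Lemma star3_fun_comp (f g h f' g' h' : nat -> nat) :
  star3_fun f g h \o star3_fun f' g' h' =1
  star3_fun (f \o f') (g \o g') (h \o h').
Proof.
move=> n; rewrite /star3_fun /=; case: (n %% 3 == 0).
  by rewrite modnMr /= mulKn.
by case: (n %% 3 == 1); rewrite mulnC modnMDl /= addnK mulnK.
Qed.

Lemma star3_fun_id (f g h : nat -> nat) :
  f =1 id -> g =1 id -> h =1 id -> star3_fun f g h =1 id.
Proof. by move=> ef eg eh n; rewrite /star3_fun ef eg eh; do ?case: ifP => ?; lia. Qed.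

Lemma star3_fun_bij (f g h : SN) : bijective (star3_fun f g h).
Proof.
exists (star3_fun (SN_inv_fun f) (SN_inv_fun g) (SN_inv_fun h)) => n.
  rewrite -[LHS]/((_ \o _) n) star3_fun_comp.
  by apply: star3_fun_id => m /=; rewrite SN_funK.
rewrite -[LHS]/((_ \o _) n) star3_fun_comp.
by apply: star3_fun_id => m /=; rewrite SN_invK.
Qed.

Definition star3 (f g h : SN) : SN := MkSN (star3_fun_bij f g h).

Lemma starM (a b c d : SN) : star (a * c)%g (b * d)%g = (star a b * star c d)%g.
Proof. by apply: SN_eqP => n; exact: (esym (star_fun_comp a b c d n)). Qed.

Lemma star1 : star 1%g 1%g = 1%g.
Proof. by apply: SN_eqP => n /=; apply: star_fun_id. Qed.

Lemma star3M (f g h f' g' h' : SN) :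
  star3 (f * f')%g (g * g')%g (h * h')%g = (star3 f g h * star3 f' g' h')%g.
Proof.
by apply: SN_eqP => n; exact: (esym (star3_fun_comp f g h f' g' h' n)).
Qed.

Lemma star31 : star3 1%g 1%g 1%g = 1%g.
Proof. by apply: SN_eqP => n /=; apply: star3_fun_id. Qed.

Definition SN3 : groupType := (SN * SN * SN)%type.

Definition tern_star (p : SN3) : SN :=
  let: (f, g, h) := p in star3 f g h.
Definition left_star (p : SN3) : SN :=
  let: (f, g, h) := p in star (star f g) h.
Definition right_star (p : SN3) : SN :=
  let: (f, g, h) := p in star f (star g h).

Fact tern_star_morphism : monoid_morphism tern_star.
Proof.
split=> [|[[f g] h] [[f' g'] h']]; first exact: star31.
by rewrite -[LHS]/(star3 (f * f') (g * g') (h * h'))%g star3M.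
Qed.
HB.instance Definition _ :=
  isUMagmaMorphism.Build SN3 SN tern_star tern_star_morphism.

Fact left_star_morphism : monoid_morphism left_star.
Proof.
split=> [|[[f g] h] [[f' g'] h']]; first by rewrite /left_star /= !star1.
by rewrite -[LHS]/(star (star (f * f') (g * g')) (h * h'))%g !starM.
Qed.
HB.instance Definition _ :=
  isUMagmaMorphism.Build SN3 SN left_star left_star_morphism.

Fact right_star_morphism : monoid_morphism right_star.
Proof.
split=> [|[[f g] h] [[f' g'] h']]; first by rewrite /right_star /= !star1.
by rewrite -[LHS]/(star (f * f') (star (g * g') (h * h')))%g !starM.
Qed.
HB.instance Definition _ :=
  isUMagmaMorphism.Build SN3 SN right_star right_star_morphism.

(* Main.v *)
(* On the three residue classes mod 3, rho is 3k -> 2k, 3k+1 -> 4k+1,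
   3k+2 -> 4k+3, while f * (g * h) acts as f on 2k, as g on 4k+1 and as h on
   4k+3; likewise lambda is 3k -> 4k, 3k+1 -> 4k+2, 3k+2 -> 2k+1, matching the
   classes of (f * g) * h. *)
Require Import Defs.
From mathcomp Require Import all_boot.
From mathcomp Require Import zify.

(** The hypothesis is the naturality square for the constant family [t]; invertibility is automatic,
    since [t] lies in a group. *)
Lemma hom_functor_nat_iso (M N : groupType) (F G : UMagmaMorphism.type M N)
    (t : N) :
  (forall m, (t * F m)%g = (G m * t)%g) ->
  exists eta : nat_trans (hom_functor F) (hom_functor G),
    is_nat_iso eta /\ forall x, eta x = t.
Proof.
move=> tFG.
exists (@NatTrans _ _ (hom_functor F) (hom_functor G) (fun=> t)
          (fun _ _ m => tFG m)).
by split=> // x; exists (t^-1)%g; split; [exact: mulVg | exact: mulgV].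
Qed.

(** Substituting [3 * k + r] for [n] replaces the divisions in [star3_fun] and [rho_fun] by linear
    formulas in [k]. *)
Lemma mod3_ind (P : nat -> Prop) :
  (forall k, P (3 * k)) -> (forall k, P (3 * k + 1)) ->
  (forall k, P (3 * k + 2)) -> forall n, P n.
Proof.
move=> P0 P1 P2 n; rewrite (divn_eq n 3) mulnC.
have : n %% 3 < 3 by rewrite ltn_mod.
by case: (n %% 3) => [|[|[|]]] // _; rewrite ?addn0.
Qed.

Lemma star_even (a b : nat -> nat) k : star_fun a b (2 * k) = 2 * a k.
Proof. by rewrite /star_fun modnMr mulKn. Qed.

Lemma star_odd (a b : nat -> nat) k : star_fun a b (2 * k + 1) = 2 * b k + 1.
Proof. by rewrite /star_fun mulnC modnMDl addnK mulnK. Qed.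

Lemma star3_mod0 (f g h : nat -> nat) k : star3_fun f g h (3 * k) = 3 * f k.
Proof. by rewrite /star3_fun modnMr mulKn. Qed.

Lemma star3_mod1 (f g h : nat -> nat) k :
  star3_fun f g h (3 * k + 1) = 3 * g k + 1.
Proof. by rewrite /star3_fun mulnC modnMDl addnK mulnK. Qed.

Lemma star3_mod2 (f g h : nat -> nat) k :
  star3_fun f g h (3 * k + 2) = 3 * h k + 2.
Proof. by rewrite /star3_fun mulnC modnMDl addnK mulnK. Qed.

Lemma rho_mod0 k : rho_fun (3 * k) = 2 * k.
Proof. by rewrite /rho_fun; do ?case: ifP => ?; lia. Qed.

(** The value [4 * k + 1] is kept in nested binary form, so that [star_odd] and then [star_even] can
    rewrite at it. *)
Lemma rho_mod1 k : rho_fun (3 * k + 1) = 2 * (2 * k) + 1.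
Proof. by rewrite /rho_fun; do ?case: ifP => ?; lia. Qed.

Lemma rho_mod2 k : rho_fun (3 * k + 2) = 2 * (2 * k + 1) + 1.
Proof. by rewrite /rho_fun; do ?case: ifP => ?; lia. Qed.

Lemma lambda_mod0 k : lambda_fun (3 * k) = 2 * (2 * k).
Proof. by rewrite /lambda_fun /= rho_mod1 addnK. Qed.

Lemma lambda_mod1 k : lambda_fun (3 * k + 1) = 2 * (2 * k + 1).
Proof. by rewrite /lambda_fun -addnA /= rho_mod2 addnK. Qed.

Lemma lambda_mod2 k : lambda_fun (3 * k + 2) = 2 * k + 1.
Proof.
(* The shift by one wraps around to residue 0, with quotient [k.+1]. *)
rewrite /lambda_fun /= (_ : 3 * k + 2 + 1 = 3 * k.+1); last by lia.
by rewrite rho_mod0; lia.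
Qed.

Lemma lambda_star3 (f g h : SN) :
  (lambda * star3 f g h)%g = (star (star f g) h * lambda)%g.
Proof.
apply: SN_eqP => /=; apply: mod3_ind => k /=.
(* [star3] preserves the residue mod 3, so the same formula for [lambda] applies on both sides,
   which become [2 * (2 * f k)]. *)
- by rewrite star3_mod0 !lambda_mod0 !star_even.
- by rewrite star3_mod1 !lambda_mod1 star_even star_odd.
- by rewrite star3_mod2 !lambda_mod2 star_odd.
Qed.

Lemma rho_star3 (f g h : SN) :
  (rho * star3 f g h)%g = (star f (star g h) * rho)%g.
Proof.
apply: SN_eqP => /=; apply: mod3_ind => k /=.
- by rewrite star3_mod0 !rho_mod0 star_even.
- by rewrite star3_mod1 !rho_mod1 star_odd star_even.
(* Both sides become [2 * (2 * h k + 1) + 1]. *)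
- by rewrite star3_mod2 !rho_mod2 !star_odd.
Qed.

Theorem proposition20 :
  (exists eta : nat_trans (hom_functor tern_star) (hom_functor left_star),
     is_nat_iso eta /\ forall x, eta x = lambda) /\
  (exists eta : nat_trans (hom_functor tern_star) (hom_functor right_star),
     is_nat_iso eta /\ forall x, eta x = rho) /\
  (forall f g h : SN,
     (lambda * star3 f g h)%g = (star (star f g) h * lambda)%g /\
     (rho * star3 f g h)%g = (star f (star g h) * rho)%g).
Proof.
split; first by apply: hom_functor_nat_iso => -[[f g] h]; exact: lambda_star3.
split; first by apply: hom_functor_nat_iso => -[[f g] h]; exact: rho_star3.
by move=> f g h; split; [exact: lambda_star3 | exact: rho_star3].
Qed.
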